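(* Let $\Gamma$ be a finite simple connected graph with $d+1$ distinct eigenvalues, with predistance polynomials $p_0,\ldots,p_d$ and preintersection numbers $\alpha_i,\beta_i,\gamma_i$. For $0\le i\le d$ let $R_i$ be the tridiagonal $(i+1)\times(i+1)$ matrix, with rows and columns indexed by $0,\ldots,i$, with diagonal entries $(R_i)_{j,j}=\alpha_j$, superdiagonal entries $(R_i)_{j,j+1}=\gamma_{j+1}$, subdiagonal entries $(R_i)_{j+1,j}=\beta_j$, and zeros elsewhere. Then $$p_i=\frac{1}{\gamma_1\gamma_2\cdots\gamma_i}\det(xI-R_{i-1}),\qquad i=1,\ldots,d.$$
   Context: Let $A$ be the adjacency matrix of $\Gamma$, $n$ the number of vertices, $\lambda_0>\lambda_1>\cdots>\lambda_d$ the distinct eigenvalues of $A$, and $m_0,\ldots,m_d$ their multiplicities. The predistance polynomials $p_0,\ldots,p_d\in\mathbb{R}[x]$ are the unique polynomials with $\deg p_i=i$ that are orthogonal with respect to $\langle f,g\rangle_\Gamma=\frac1n\operatorname{tr}(f(A)g(A))=\frac1n\sum_{i=0}^d m_i f(\lambda_i)g(\lambda_i)$ and normalized so that $\|p_i\|_\Gamma^2=p_i(\lambda_0)$. The preintersection numbers $\alpha_i,\beta_i,\gamma_i$ considered are the coefficients of the three-term recurrence $xp_i=\beta_{i-1}p_{i-1}+\alpha_ip_i+\gamma_{i+1}p_{i+1}$, $i=0,\ldots,d$, with $\beta_{-1}=\gamma_{d+1}=0$ (for $i\le d-1$ an identity of polynomials; for $i=d$ an identity modulo the minimal polynomial $\prod_{i=0}^d(x-\lambda_i)$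 of $A$). *)

(* Defs.v *)
From HB Require Import structures.
From mathcomp Require Import all_boot all_order all_algebra.
From mathcomp Require Import reals.

Set Implicit Arguments.
Unset Strict Implicit.
Unset Printing Implicit Defensive.

Import Order.TTheory GRing.Theory Num.Theory.
Local Open Scope ring_scope.

Definition simple_connected_graph (T : finType) (e : rel T) : Prop :=
  [/\ symmetric e, irreflexive e & forall x y : T, connect e x y].

(* The number of vertices is written n.+1 so that horner_mx and mxminpoly,
   which need a size of this form, apply; the vertices are listed by enum. *)
Definition adjacency_mx (R : realType) (T : finType) (e : rel T) (n : nat)
    (cardT : #|T| = n.+1) : 'M[R]_n.+1 :=
  let vertex (i : 'I_n.+1) : T := enum_val (cast_ord (esym cardT) i) in
  \matrix_(i, j) (e (vertex i) (vertex j))%:R.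

Definition distinct_eigenvalues (R : realType) (n d : nat) (A : 'M[R]_n.+1)
    (lam : d.+1.-tuple R) : Prop :=
  sorted >%R lam /\ (forall x : R, eigenvalue A x = (x \in lam)).

Definition inner (R : realType) (n : nat) (A : 'M[R]_n.+1)
    (f g : {poly R}) : R :=
  (n.+1%:R)^-1 * \tr (horner_mx A f *m horner_mx A g).

(* Only the values p 0, ..., p d are constrained. *)
Definition predistance_polynomials (R : realType) (n d : nat) (A : 'M[R]_n.+1)
    (lam : d.+1.-tuple R) (p : nat -> {poly R}) : Prop :=
  [/\ forall i, (i <= d)%N -> size (p i) = i.+1,
      forall i j, (i <= d)%N -> (j <= d)%N -> i != j ->
        inner A (p i) (p j) = 0
    & forall i, (i <= d)%N ->
        inner A (p i) (p i) = (p i).[tnth lam ord0]].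

(* The conventions beta_{-1} = 0 and gamma_{d+1} = 0 are encoded by omitting
   the corresponding terms. *)
Definition preintersection_numbers (R : realType) (n d : nat)
    (A : 'M[R]_n.+1) (p : nat -> {poly R}) (alpha beta gamma : nat -> R)
    : Prop :=
  let lower i := if i is k.+1 then beta k *: p k else 0 in
  (forall i, (i < d)%N ->
     'X * p i = lower i + alpha i *: p i + gamma i.+1 *: p i.+1) /\
  ('X * p d) %% mxminpoly A = (lower d + alpha d *: p d) %% mxminpoly A.

Definition recurrence_mx (R : realType) (alpha beta gamma : nat -> R)
    (i : nat) : 'M[R]_i.+1 :=
  \matrix_(j, k)
    if j == k then alpha j
    else if k == j.+1 :> nat then gamma k
    else if j == k.+1 :> nat then beta k
    else 0.

(* Main.v *)
Require Import Defs.
From mathcomp Require Import all_boot all_order all_algebra.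
From mathcomp Require Import reals.
From mathcomp Require Import ring zify.
Import GRing.Theory Num.Theory.
Local Open Scope ring_scope.

(** Both sides of the formula obey the same recurrence. Put
    D_i = det(xI - R_{i-1}), with D_0 = 1. Expanding this tridiagonal
    determinant along its last row and then its last column
    ([det_tridiagonal_rec]) gives
      D_{i+2} = (x - alpha_{i+1}) D_{i+1} - gamma_{i+1} beta_i D_i.
    On the other hand, multiplying the three-term recurrence
      gamma_{i+2} p_{i+2} = (x - alpha_{i+1}) p_{i+1} - beta_i p_i
    by gamma_1 ... gamma_{i+1} shows that the polynomials
    gamma_1 ... gamma_i p_i satisfy exactly this recurrence. The initial
    value p_0 = 1 comes from the normalization ([predistance0]), and one may
    divide by the gamma_j because x p_{j-1} has degree j, so that the term
    gamma_j p_j cannot vanish ([preintersection_gamma_neq0]). *)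

(** The last row has only two entries to expand along. The minor of the
    diagonal one is the next smaller section; in the minor of the other one
    the last column has a single entry, and removing it leaves the section
    two sizes smaller. *)
Lemma det_tridiagonal_rec (S : comPzRingType) (t : nat -> nat -> S) (n : nat)
    (last_row0 : forall k, (k < n)%N -> t n.+1 k = 0)
    (last_col0 : forall j, (j < n)%N -> t j n.+1 = 0) :
  \det (\matrix_(j < n.+2, k < n.+2) t j k) =
    t n.+1 n.+1 * \det (\matrix_(j < n.+1, k < n.+1) t j k)
    - t n n.+1 * t n.+1 n * \det (\matrix_(j < n, k < n) t j k).
Proof.
rewrite (expand_det_row _ ord_max) !big_ord_recr /=.
rewrite big1 ?add0r => [|k _]; last by rewrite mxE /= last_row0 ?mul0r.
have cofactor_corner :
    cofactor (\matrix_(j < n.+2, k < n.+2) t j k) ord_max ord_max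
      = \det (\matrix_(j < n.+1, k < n.+1) t j k).
  rewrite /cofactor -signr_odd oddD addbb mul1r.
  by congr (\det _); apply/matrixP => j k; rewrite !mxE !lift_max.
have cofactor_next :
    cofactor (\matrix_(j < n.+2, k < n.+2) t j k) ord_max
        (widen_ord (leqnSn n.+1) ord_max)
      = - (t n n.+1 * \det (\matrix_(j < n, k < n) t j k)).
  rewrite /cofactor -signr_odd addSn oddS oddD addbb /= mulN1r; congr (- _).
  rewrite (expand_det_col _ ord_max) big_ord_recr /=.
  rewrite big1 ?add0r => [|j _]; last first.
    rewrite !mxE lift_max /= /bump leqnn add1n.
    by rewrite last_col0 ?mul0r.
  rewrite /cofactor -signr_odd oddD addbb mul1r !mxE lift_max /=.
  rewrite /bump leqnn add1n; congr (_ * \det _).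
  apply/matrixP => j k; rewrite !mxE !lift_max /=.
  by rewrite /bump [(n <= k)%N]leqNgt ltn_ord add0n leqNgt ltn_ord.
rewrite cofactor_corner cofactor_next !mxE /=.
ring.
Qed.

Section Recurrence.

Set Implicit Arguments.
Unset Strict Implicit.

Context {R : realType}.
Implicit Types (alpha beta gamma : nat -> R) (p : nat -> {poly R}).

(** Indexing the entries of xI - R_i by all of [nat] presents the matrices of
    all sizes as sections of one array. *)
Definition char_entry alpha beta gamma (j k : nat) : {poly R} :=
  'X *+ (j == k) - (if j == k then alpha j
                    else if k == j.+1 then gamma k
                    else if j == k.+1 then beta k else 0)%:P.

(** This is the polynomial D_i = det(xI - R_{i-1}). Indexing it by the size of
    the matrix admits the empty matrix, so that D_0 = 1 matches p_0 = 1. *)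
Definition continuant alpha beta gamma (i : nat) : {poly R} :=
  \det (\matrix_(j < i, k < i) char_entry alpha beta gamma j k).

Lemma char_poly_recurrence_mxE alpha beta gamma i :
  char_poly (recurrence_mx alpha beta gamma i)
    = continuant alpha beta gamma i.+1.
Proof. by congr (\det _); apply/matrixP => j k; rewrite !mxE. Qed.

Lemma char_entry_far0 alpha beta gamma j k :
  (j.+1 < k)%N || (k.+1 < j)%N -> char_entry alpha beta gamma j k = 0.
Proof.
rewrite /char_entry => far.
have [ne_jk ne_kSj ne_jSk] : [/\ j != k, k != j.+1 & j != k.+1].
  by split; lia.
by rewrite (negPf ne_jk) (negPf ne_kSj) (negPf ne_jSk) mulr0n subr0.
Qed.

Lemma continuant_rec alpha beta gamma i :
  continuant alpha beta gamma i.+2 =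
    ('X - (alpha i.+1)%:P) * continuant alpha beta gamma i.+1
    - (gamma i.+1 * beta i)%:P * continuant alpha beta gamma i.
Proof.
rewrite /continuant det_tridiagonal_rec; first last.
- by move=> j lt_ji; apply: char_entry_far0; rewrite !ltnS lt_ji.
- by move=> k lt_ki; apply: char_entry_far0; rewrite !ltnS lt_ki orbT.
rewrite /char_entry !eqxx (ltn_eqF (ltnSn i)) (gtn_eqF (ltnSn i)).
rewrite (ltn_eqF (leqW (ltnSn i))).
by rewrite !mulr0n !sub0r mulrNN polyCM.
Qed.

(** A nonzero constant c has square norm c^2, since the inner product is
    normalized so that 1 has norm 1; hence c^2 = c forces c = 1. *)
Lemma predistance0 n d (A : 'M[R]_n.+1) (lam : d.+1.-tuple R) p :
  predistance_polynomials A lam p -> p 0%N = 1.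
Proof.
case=> size_p _ norm_p.
have /eqP/size_poly1P [c c_neq0 p0E] := size_p 0%N (leq0n d).
have := norm_p 0%N (leq0n d).
rewrite /inner p0E hornerC horner_mx_C -scalar_mxM mxtrace_scalar.
rewrite -[c * c *+ _]mulr_natl mulKf ?pnatr_eq0 //.
by rewrite -{3}[c]mul1r => /(mulIf c_neq0) ->.
Qed.

(** In the recurrence for x p_i, of degree i+1, every term but the one with
    gamma_{i+1} has degree at most i. *)
Lemma preintersection_gamma_neq0 n d (A : 'M[R]_n.+1) (lam : d.+1.-tuple R) p
    alpha beta gamma :
    predistance_polynomials A lam p ->
    preintersection_numbers d A p alpha beta gamma ->
  forall i, (i < d)%N -> gamma i.+1 != 0.
Proof.
case=> size_p _ _ [rec_p _] i lt_id; have le_id := ltnW lt_id.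
apply/eqP => gamma0; have := rec_p i lt_id; rewrite gamma0 scale0r addr0.
move/(congr1 (fun q : {poly R} => size q)).
have p_neq0 : p i != 0 by rewrite -size_poly_eq0 size_p.
rewrite mulrC size_mulX // size_p // => sizeE.
suff : (i.+2 <= i.+1)%N by rewrite ltnn.
rewrite [X in (X <= _)%N]sizeE.
apply: leq_trans (size_polyD _ _) _; rewrite geq_max; apply/andP; split.
  case: i lt_id le_id {gamma0 sizeE p_neq0} => [|k] lt_kd le_kd.
    by rewrite size_poly0.
  by apply: leq_trans (size_scale_leq _ _) _; rewrite size_p; lia.
by apply: leq_trans (size_scale_leq _ _) _; rewrite size_p.
Qed.

(** The division-free form of the formula, which holds for any solution of
    the three-term recurrence starting at 1. The two-step recurrence calls for
    an induction that carries two consecutive indices. *)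
Lemma continuant_three_term d p alpha beta gamma :
    p 0%N = 1 ->
    (forall i, (i < d)%N ->
       'X * p i = (if i is k.+1 then beta k *: p k else 0)
                  + alpha i *: p i + gamma i.+1 *: p i.+1) ->
  forall i, (i <= d)%N ->
    continuant alpha beta gamma i
      = (\prod_(1 <= j < i.+1) gamma j) *: p i.
Proof.
move=> p0 rec_p.
have step i : (i < d)%N -> gamma i.+1 *: p i.+1 =
    ('X - (alpha i)%:P) * p i - (if i is k.+1 then beta k *: p k else 0).
  move=> lt_id; rewrite mulrBl rec_p // mul_polyC [X in _ = X - _]addrAC addrK.
  by rewrite [RHS]addrC addKr.
pose formula i := (i <= d)%N ->
  continuant alpha beta gamma i = (\prod_(1 <= j < i.+1) gamma j) *: p i.
suff both i : formula i /\ formula i.+1 by move=> i; case: (both i).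
elim: i => [|i [IHi IHi1]]; split=> //.
- by move=> _; rewrite /continuant det_mx00 big_geq // scale1r p0.
- move=> d_gt0; rewrite big_nat1 step // p0 mulr1 subr0.
  by rewrite /continuant det_mx11 mxE.
- move=> lt_id; have le_id := ltnW lt_id.
  rewrite continuant_rec IHi1 // IHi 1?ltnW //.
  rewrite [in RHS]big_nat_recr //= -scalerA step //.
  rewrite !(@big_nat_recr _ _ _ i.+1) //= -!mul_polyC !polyCM.
  ring.
Qed.

End Recurrence.

Theorem proposition3p4 (R : realType) (T : finType) (e : rel T) (n d : nat)
    (cardT : #|T| = n.+1) (lam : d.+1.-tuple R) (p : nat -> {poly R})
    (alpha beta gamma : nat -> R)
    (graph_e : simple_connected_graph e)
    (lamP : distinct_eigenvalues (adjacency_mx R e cardT) lam)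
    (pP : predistance_polynomials (adjacency_mx R e cardT) lam p)
    (abcP : preintersection_numbers d (adjacency_mx R e cardT) p
              alpha beta gamma) :
  forall i : nat, (1 <= i <= d)%N ->
    p i = (\prod_(1 <= j < i.+1) gamma j)^-1
            *: char_poly (recurrence_mx alpha beta gamma i.-1).
Proof.
case=> [//|i] /= lt_id.
rewrite char_poly_recurrence_mxE.
rewrite (continuant_three_term (predistance0 pP) abcP.1) // scalerK //.
rewrite big_nat_cond prodf_seq_neq0; apply/allP => -[|j] _ //=.
apply/implyP => j_range; apply: (preintersection_gamma_neq0 pP abcP).
by move: j_range lt_id; lia.
Qed.
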